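(* Let $A$ and $B$ be unital $C^*$-algebras, let $E$ be a Hilbert $A$-module and $F$ a Hilbert $B$-module. Let $\{u_i\}_{i\in I}$ and $\{v_j\}_{j\in J}$ ($I,J$ countable index sets) be orthonormal bases in $E$ and $F$, respectively. Then $\{u_i\otimes v_j\}_{i\in I,\,j\in J}$ is an orthonormal basis for the Hilbert $A\otimes B$-module $E\otimes F$.
   Context: A Hilbert $A$-module is a left $A$-module $H$ (with compatible linear structures) equipped with an $A$-valued inner product $\langle\cdot,\cdot\rangle$ such that $\langle x,x\rangle\ge 0$, with equality iff $x=0$; $\langle ax+y,z\rangle=a\langle x,z\rangle+\langle y,z\rangle$ for $a\in A$; $\langle x,y\rangle=\langle y,x\rangle^*$; and $H$ is complete for $\|x\|=\|\langle x,x\rangle\|^{1/2}$. An element $v\in H$ is basic if $e=\langle v,v\rangle$ is a minimal projection in $A$, i.e. $e$ is a (nonzero) projection with $eAe=\mathbb{C}e$. A system $\{v_\lambda\}_{\lambda\in\Lambda}$ of basic elements is orthonormal if $\langle v_\lambda,v_\mu\rangle=0$ for all $\lambda\neq\mu$. An orthonormal basis for $H$ is an orthonormal system which generates a dense submodule of $H$. $A\otimes B$ is the completion of the algebraic tensor product in the spatial (minimal) $C^*$-norm. $E\otimes F$ is the Hilbert $A\otimes B$-module obtained by completing the algebraic tensor product of $E$ and $F$ with module action $(a\otimes b)(x\otimes y)=ax\otimes by$ and inner product $\langle x_1\otimes y_1,x_2\otimes y_2\rangle=\langle x_1,x_2\rangle\otimes\langle y_1,y_2\rangle$. *)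

(* Defs.v *)
From HB Require Import structures.
From mathcomp Require Import all_boot all_order all_algebra.
From mathcomp Require Import all_classical all_reals all_analysis.
From mathcomp Require Import complex.

Set Implicit Arguments.
Unset Strict Implicit.
Unset Printing Implicit Defensive.

Import Order.TTheory GRing.Theory Num.Theory.
Import numFieldNormedType.Exports.

Local Open Scope classical_set_scope.
Local Open Scope ring_scope.

(* Throughout, the scalars are the complex numbers R[i], so that norms are
   R[i]-valued (real and nonnegative), and inner products are linear in the
   first argument. *)

(* Unital C*-algebras, the zero algebra included. Hierarchy-Builder rejects a join
   of rings with normed modules declared after numDomainType, so the ring
   operations are fields here, and the ring structure is an instance on the
   carriers. *)
HB.mixin Record isCStarAlgebra (R : realType) A
    of CompleteNormedModule R[i] A := {
  cone : A;
  cmul : A -> A -> A;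
  cmulA : associative cmul;
  cmul1l : left_id cone cmul;
  cmul1r : right_id cone cmul;
  cmulDl : left_distributive cmul +%R;
  cmulDr : right_distributive cmul +%R;
  cscaleAl : forall (c : R[i]) (a b : A), c *: cmul a b = cmul (c *: a) b;
  cscaleAr : forall (c : R[i]) (a b : A), c *: cmul a b = cmul a (c *: b);
  cnormM : forall a b : A, `|cmul a b| <= `|a| * `|b|;
  star : A -> A;
  starK : involutive star;
  starD : {morph star : a b / a + b};
  starZ : forall (c : R[i]) (a : A), star (c *: a) = c^* *: star a;
  starM : forall a b : A, star (cmul a b) = cmul (star b) (star a);
  cstar_norm : forall a : A, `|cmul (star a) a| = `|a| ^+ 2
}.

#[short(type="cstarType")]
HB.structure Definition CStarAlgebra (R : realType) :=
  {A of CompleteNormedModule R[i] A & isCStarAlgebra R A}.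

#[non_forgetful_inheritance]
HB.instance Definition _ (R : realType) (A : cstarType R) :=
  GRing.Zmodule_isPzRing.Build A cmulA cmul1l cmul1r cmulDl cmulDr.

HB.mixin Record isHilbertSpace (R : realType) H
    of CompleteNormedModule R[i] H := {
  dot : H -> H -> R[i];
  dot_linear : forall (c : R[i]) (x y z : H),
    dot (c *: x + y) z = c * dot x z + dot y z;
  dotC : forall x y : H, dot x y = (dot y x)^*;
  dot_norm : forall x : H, `|x| ^+ 2 = dot x x
}.

#[short(type="hilbertType")]
HB.structure Definition HilbertSpace (R : realType) :=
  {H of CompleteNormedModule R[i] H & isHilbertSpace R H}.

Definition cstar_pos (R : realType) (A : cstarType R) (a : A) : Prop :=
  exists b : A, a = star b * b.

(* The action of A is a field of the mixin and not an lmodType structure, since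
   the module already is an lmodType over the scalars R[i]. *)
HB.mixin Record isHilbertModule (R : realType) (A : cstarType R) E
    of CompleteNormedModule R[i] E := {
  act : A -> E -> E;
  act1 : forall x : E, act 1 x = x;
  actM : forall (a b : A) (x : E), act (a * b) x = act a (act b x);
  actDl : forall (a b : A) (x : E), act (a + b) x = act a x + act b x;
  actDr : forall (a : A) (x y : E), act a (x + y) = act a x + act a y;
  actZl : forall (c : R[i]) (a : A) (x : E), act (c *: a) x = c *: act a x;
  actZr : forall (c : R[i]) (a : A) (x : E), act a (c *: x) = c *: act a x;
  inner : E -> E -> A;
  inner_ge0 : forall x : E, cstar_pos (inner x x);
  inner_eq0 : forall x : E, inner x x = 0 <-> x = 0;
  inner_linear : forall (a : A) (x y z : E),
    inner (act a x + y) z = a * inner x z + inner y z;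
  innerC : forall x y : E, inner x y = star (inner y x);
  inner_norm : forall x : E, `|x| = sqrtC `|inner x x|
}.

#[short(type="hilbertModType")]
HB.structure Definition HilbertModule (R : realType) (A : cstarType R) :=
  {E of CompleteNormedModule R[i] E & isHilbertModule R A E}.

Section OrthonormalBasis.
Variables (R : realType) (A : cstarType R).

Definition projection (e : A) : Prop := star e = e /\ e * e = e.

Definition minimal_projection (e : A) : Prop :=
  [/\ projection e, e != 0 &
      [set e * a * e | a in [set: A]] = [set c *: e | c in [set: R[i]]]].

Variable E : hilbertModType A.

Definition basic (v : E) : Prop := minimal_projection (inner v v).

Variables (L : Type) (v : L -> E).

Definition orthonormal_system : Prop :=
  (forall l, basic (v l)) /\ (forall l m, l <> m -> inner (v l) (v m) = 0).

Definition generated_submodule : set E :=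
  [set x | exists s : seq (A * L), x = \sum_(p <- s) act p.1 (v p.2)].

Definition orthonormal_basis : Prop :=
  orthonormal_system /\ dense generated_submodule.

End OrthonormalBasis.

(* A sequence of pairs s represents the element \sum_(p <- s) p.1 (x) p.2 of an
   algebraic tensor product. *)
Section SpatialNorm.
Variable R : realType.

Section HilbertTensor.
Variables H K : hilbertType R.

(* <s, s> for <h (x) k, h' (x) k'> = <h, h'> <k, k'> *)
Definition tensor_sqnorm (s : seq (H * K)) : R[i] :=
  \sum_(p <- s) \sum_(q <- s) dot p.1 q.1 * dot p.2 q.2.

Definition tensor_norm (s : seq (H * K)) : R :=
  Num.sqrt (complex.Re (tensor_sqnorm s)).

End HilbertTensor.

(* pi is a *-homomorphism from A to the bounded operators on H; it need not be
   unital. *)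
Record star_representation (A : cstarType R) (H : hilbertType R)
    (pi : A -> H -> H) : Prop := StarRepresentation {
  rep_linear : forall a, linear (pi a);
  rep_bounded : forall a, exists M : R[i], forall x, `|pi a x| <= M * `|x|;
  rep_linearl : forall x, linear (pi^~ x);
  repM : forall a b x, pi (a * b) x = pi a (pi b x);
  rep_star : forall a x y, dot (pi a x) y = dot x (pi (star a) y)
}.

Variables A B : cstarType R.

(* (pi (x) rho)(t) applied to s *)
Definition tensor_apply (H K : hilbertType R) (pi : A -> H -> H)
    (rho : B -> K -> K) (t : seq (A * B)) (s : seq (H * K)) : seq (H * K) :=
  [seq (pi p.1 q.1, rho p.2 q.2) | p <- t, q <- s].

(* The spatial norm of t is the supremum of the operator norms of
   (pi (x) rho)(t) on the Hilbert tensor product of H and K, over all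
   representations pi of A on H and rho of B on K; an operator norm is computed
   on the unit ball of the dense algebraic tensor product of H and K. *)
Definition spatial_norm (t : seq (A * B)) : \bar R :=
  ereal_sup [set r | exists (H K : hilbertType R) (pi : A -> H -> H)
      (rho : B -> K -> K) (s : seq (H * K)),
    [/\ star_representation pi, star_representation rho, tensor_norm s <= 1
      & r = (tensor_norm (tensor_apply pi rho t s))%:E]].

End SpatialNorm.

(* AB, with tens a b = a (x) b, is the completion of the algebraic tensor
   product of A and B in the spatial norm. This determines AB up to a unique
   isometric *-isomorphism compatible with tens. *)
Record is_spatial_tensor (R : realType) (A B AB : cstarType R)
    (tens : A -> B -> AB) : Prop := IsSpatialTensor {
  tens_linearl : forall b, linear (tens^~ b);
  tens_linearr : forall a, linear (tens a);
  tens1 : tens 1 1 = 1;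
  tensM : forall a a' b b', tens a b * tens a' b' = tens (a * a') (b * b');
  tens_star : forall a b, star (tens a b) = tens (star a) (star b);
  tens_norm : forall t : seq (A * B),
    (complex.Re `|\sum_(p <- t) tens p.1 p.2|)%:E = spatial_norm t;
  tens_dense :
    dense [set c | exists t : seq (A * B), c = \sum_(p <- t) tens p.1 p.2]
}.

(* EF, with mtens x y = x (x) y, is the Hilbert AB-module completing the
   algebraic tensor product of E and F; it is again determined up to a unique
   isomorphism. *)
Record is_module_tensor (R : realType) (A B AB : cstarType R)
    (tens : A -> B -> AB) (E : hilbertModType A) (F : hilbertModType B)
    (EF : hilbertModType AB) (mtens : E -> F -> EF) : Prop := IsModuleTensor {
  mtens_linearl : forall y, linear (mtens^~ y);
  mtens_linearr : forall x, linear (mtens x);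
  mtens_act : forall a b x y,
    act (tens a b) (mtens x y) = mtens (act a x) (act b y);
  mtens_inner : forall x1 x2 y1 y2,
    inner (mtens x1 y1) (mtens x2 y2) = tens (inner x1 x2) (inner y1 y2);
  mtens_dense :
    dense [set z | exists s : seq (E * F), z = \sum_(p <- s) mtens p.1 p.2]
}.

(* Main.v *)
Require Import Defs.
From HB Require Import structures.
From mathcomp Require Import all_boot all_order all_algebra.
From mathcomp Require Import all_classical all_reals all_analysis.
From mathcomp Require Import complex.

Set Implicit Arguments.
Unset Strict Implicit.
Unset Printing Implicit Defensive.

Import Order.TTheory GRing.Theory Num.Theory.
Import numFieldNormedType.Exports.

Local Open Scope classical_set_scope.
Local Open Scope ring_scope.

(** Let e = <u_i, u_i> and f = <v_j, v_j>. The inner product of two elements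
    u_i (x) v_j is a tensor of inner products, so orthogonality is immediate and
    what remains is that e (x) f is a minimal projection and that the elements
    u_i (x) v_j generate a dense submodule.

    - e (x) f is nonzero. The spatial norm is a supremum over pairs of
      representations, so one representation of A that does not kill e is
      needed, and likewise for f. Minimality of e provides it without the general
      GNS construction: in the left ideal A e, the elements y^* x lie in
      e A e = C e, so y^* x = (x, y) e defines a scalar product whose norm is the
      norm of A. Hence the closed ideal A e is already a Hilbert space, on which
      A acts by left multiplication, and e is a unit vector fixed by e
      ([ideal_mul_representation], [ideal_mul_unit]). Positivity of this product
      is the only delicate point; it is an algebraic special case of the
      positivity of x^* x ([minimal_star_mul_ge0]).

    - The corner of A (x) B at e (x) f is C (e (x) f). This is clear for
      compressions of finite sums of elementary tensors. Those sums are dense,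
      compression is bounded, and a line is closed ([line_closed]), which settles
      the other elements ([tens_minimal_projection]).

    - Density. If |x (x) y| <= |x| |y| in E (x) F, then approximating x by
      combinations of the u_i and y by combinations of the v_j approximates
      x (x) y, hence all finite sums, hence everything
      ([mtens_dense_generated]). Since |x|^2 = |<x, x>|, the bound follows from
      |a (x) b| <= |a| |b| ([norm_tens_le]), and this from the fact that unital
      *-homomorphisms, here a |-> a (x) 1 and b |-> 1 (x) b, are contractive
      ([unital_star_morphism_contractive]). For the latter, a self-adjoint h of
      norm less than 1 is the real part of the unitary
      h + i (1 - h^2)^(1/2), whose image is unitary, hence of norm at most 1. *)

(** * Linear functions given by a predicate *)

Section LinearFunctions.
Variables (K : nzRingType) (U V : lmodType K) (f : U -> V) (f_lin : linear f).

Let g : {linear U -> V} := HB.pack f (GRing.isLinear.Build K U V *:%R f f_lin).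

Lemma linear_fun0 : f 0 = 0. Proof. exact: (raddf0 g). Qed.

Lemma linear_funB x y : f (x - y) = f x - f y. Proof. exact: (raddfB g). Qed.

Lemma linear_funZ c x : f (c *: x) = c *: f x.
Proof. exact: (linearZ_LR g). Qed.

Lemma linear_fun_sum (T : Type) (s : seq T) (F : T -> U) :
  f (\sum_(i <- s) F i) = \sum_(i <- s) f (F i).
Proof. exact: (raddf_sum g). Qed.

End LinearFunctions.

(** * Elementary facts on C*-algebras *)

Section CStarAlgebraTheory.
Variables (R : realType) (A : cstarType R).
Implicit Types (a b : A) (c : R[i]).

(** The axioms of C*-algebras are about the operation [cmul]; this lemma and the
    next four restate them for the multiplication of the ring structure, to
    which the lemmas on rings apply. *)
Lemma starMr a b : star (a * b) = star b * star a.
Proof. exact: starM. Qed.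

Lemma mulrZl c a b : (c *: a) * b = c *: (a * b).
Proof. by rewrite [RHS]cscaleAl. Qed.

Lemma mulrZr c a b : a * (c *: b) = c *: (a * b).
Proof. by rewrite [RHS]cscaleAr. Qed.

Lemma norm_mulr a b : `|a * b| <= `|a| * `|b|.
Proof. exact: cnormM. Qed.

Lemma norm_star_mul a : `|star a * a| = `|a| ^+ 2.
Proof. exact: cstar_norm. Qed.

Lemma star0 : star (0 : A) = 0.
Proof. by have := starZ 0 (0 : A); rewrite conjC0 !scale0r. Qed.

Lemma starN a : star (- a) = - star a.
Proof. by apply/eqP; rewrite -subr_eq0 opprK -starD addNr star0. Qed.

Lemma starB a b : star (a - b) = star a - star b.
Proof. by rewrite starD starN. Qed.

Lemma star1 : star (1 : A) = 1.
Proof. by rewrite -[LHS]mulr1 -[X in _ * X]starK -starMr mulr1 starK. Qed.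

Lemma norm_star a : `|star a| = `|a|.
Proof.
have le b : `|b| <= `|star b|.
  have [->|b0] := eqVneq b 0; first by rewrite normr0.
  rewrite -(ler_pM2r (_ : 0 < `|b|)) ?normr_gt0// -expr2 -norm_star_mul.
  exact: norm_mulr.
by apply/eqP; rewrite eq_le le andbT -{2}[a]starK le.
Qed.

Lemma norm_projection_le1 a : projection a -> `|a| <= 1.
Proof.
case=> sa aa; have := norm_star_mul a; rewrite sa aa expr2.
have [->|a0] := eqVneq a 0; first by rewrite normr0.
by rewrite -{1}[`|a|]mul1r => /(mulIf _) <- //; rewrite normr_eq0.
Qed.

Lemma norm_unitary_le1 a : star a * a = 1 -> `|a| <= 1.
Proof.
move=> aa; rewrite -(@expr_le1 _ 2)// -norm_star_mul aa.
by apply: norm_projection_le1; split; rewrite ?star1 ?mulr1.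
Qed.

End CStarAlgebraTheory.

(** * Minimal projections and the sign of x^* x *)

Section MinimalProjections.
Variables (R : realType) (A : cstarType R).
Implicit Types (a b e h q x z : A) (c : R[i]).

(** A self-adjoint square cannot be negative: the element w = h + i q satisfies
    w^* w = h^2 + q = 0, so that h = - i q is both self-adjoint and
    anti-self-adjoint. *)
Lemma sqr_eq_oppr_projection h q :
  star h = h -> projection q -> h * q = h -> h * h = - q -> q = 0.
Proof.
move=> sh [sq qq] hq hh.
have qh : q * h = h by rewrite -[in LHS]sh -[in LHS]sq -starMr hq sh.
have sw : star (h + 'i *: q) = h - 'i *: q.
  by rewrite starD starZ sh sq conjCi scaleNr.
have /eqP : `|h + 'i *: q| ^+ 2 = 0.
  rewrite -norm_star_mul sw mulrDr !mulrBl !mulrZl !mulrZr hh hq qh qq.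
  rewrite scalerA -expr2 sqrCi scaleN1r opprK addrA subrK addNr.
  exact: normr0.
rewrite expf_eq0 normr_eq0 addr_eq0/= => /eqP hiq.
have : 'i *: q = - ('i *: q).
  by rewrite -hiq -sh hiq starN starZ sq conjCi scaleNr opprK.
move/eqP; rewrite -subr_eq0 opprK -scalerDl scaler_eq0 -mulr2n mulrn_eq0/=.
by rewrite (negbTE (neq0Ci _)) => /eqP.
Qed.

(** Put p = - z z^*. Since z maps e A into the complement of e, p is a projection
    orthogonal to e, and the self-adjoint element h = z + z^* has square
    - (e + p). *)
Lemma star_mul_neq_oppr_projection e z : projection e -> z * e = z ->
  e * z = 0 -> star z * z = - e -> e = 0.
Proof.
move=> [se ee] ze ez zz.
have zz0 : z * z = 0 by rewrite -{1}ze -mulrA ez mulr0.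
have sze : star z * e = 0 by rewrite -se -starMr ez star0.
have esz : e * star z = star z by rewrite -[in LHS]se -starMr ze.
pose p := - (z * star z).
have sp : star p = p by rewrite /p starN starMr starK.
have pp : p * p = p.
  by rewrite /p mulrNN mulrA -(mulrA z) zz mulrN ze mulNr.
have ep : e * p = 0 by rewrite /p mulrN mulrA ez mul0r oppr0.
have pe : p * e = 0 by rewrite -sp -se -starMr ep star0.
suff q0 : e + p = 0 by rewrite -ee -[RHS](mulr0 e) -q0 mulrDr ep addr0.
apply: (@sqr_eq_oppr_projection (z + star z)).
- by rewrite starD starK addrC.
- by split; rewrite ?starD ?se ?sp// mulrDl !mulrDr ee ep pe pp addr0 add0r.
- rewrite mulrDl !mulrDr ze sze add0r /p !mulrN !mulrA zz0 mul0r oppr0 addr0 zz.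
  by rewrite mulNr opprK esz.
- rewrite mulrDl !mulrDr zz0 add0r zz -[star z * star z]starMr zz0 star0.
  by rewrite addr0 /p opprD opprK addrC.
Qed.

(** For minimal e, this is the state of A given by the unit vector e in the
    representation of A on the left ideal A e constructed below. *)
Definition corner_coef e a : R[i] := xget 0 [set c | e * a * e = c *: e].

Section MinimalProjection.
Variables (e : A) (he : minimal_projection e).

Let se : star e = e. Proof. by case: he => -[]. Qed.
Let ee : e * e = e. Proof. by case: he => -[]. Qed.
Let e0 : e != 0. Proof. by case: he. Qed.

Lemma minimal_scaleI : injective (fun c : R[i] => c *: e).
Proof.
move=> c d /eqP; rewrite -subr_eq0 -scalerBl scaler_eq0 (negbTE e0) orbF.
by rewrite subr_eq0 => /eqP.
Qed.

Lemma norm_minimal_projection : `|e| = 1.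
Proof.
have n0 : `|e| != 0 by rewrite normr_eq0.
by apply: (mulIf n0); rewrite mul1r -expr2 -norm_star_mul se ee.
Qed.

Lemma corner_coefE a : e * a * e = corner_coef e a *: e.
Proof.
rewrite /corner_coef; case: xgetP => //= none; exfalso.
case: he => _ _ /seteqP[/(_ (e * a * e))+ _] => -[|c _ ce]; first by exists a.
exact: (none c).
Qed.

(** Suppose c < 0. Subtracting from x its component e x = (e x e) along e makes
    x^* x more negative and x orthogonal to e; after rescaling this contradicts
    [star_mul_neq_oppr_projection]. *)
Lemma minimal_star_mul_ge0 x c : x * e = x -> star x * x = c *: e -> 0 <= c.
Proof.
move=> xe xx.
have cr : c \is Num.real.
  apply/CrealP; apply: minimal_scaleI; rewrite -{1}se -starZ -xx.
  by rewrite starMr starK.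
have [//|c0] := real_leP (real0 _) cr; exfalso.
pose f := corner_coef e x.
have ex : e * x = f *: e by rewrite -corner_coefE -mulrA xe.
have sxe : star x * e = f^* *: e by rewrite -[in LHS]se -starMr ex starZ se.
pose z := x - f *: e.
have ze : z * e = z by rewrite mulrBl xe mulrZl ee.
have ez : e * z = 0 by rewrite mulrBr ex mulrZr ee subrr.
pose d := `|f| ^+ 2 - c.
have d0 : 0 < d by rewrite subr_gt0 (lt_le_trans c0)// exprn_ge0.
have zz : star z * z = - (d *: e).
  rewrite starB starZ se mulrBl !mulrBr xx mulrZr sxe !mulrZl ex !mulrZr ee.
  rewrite !scalerA subrr subr0 -scalerBl -[RHS]scaleNr.
  by rewrite opprB normCK.
pose s := (sqrtC d)^-1.
have ss : s^* * s * d = 1.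
  have s_ge0 : 0 <= s by rewrite invr_ge0 sqrtC_ge0 ltW.
  rewrite (CrealP (ger0_real s_ge0)) -expr2 exprVn sqrtCK mulVf//.
  by rewrite gt_eqF.
apply/negP: e0; rewrite negbK; apply/eqP.
apply: (@star_mul_neq_oppr_projection e (s *: z)) => //.
- by rewrite mulrZl ze.
- by rewrite mulrZr ez scaler0.
- by rewrite starZ mulrZl mulrZr zz !scalerN !scalerA ss scale1r.
Qed.

End MinimalProjection.
End MinimalProjections.

(** * The Hilbert space of a minimal left ideal *)

Section RightFixedIdeal.
Variables (R : realType) (A : cstarType R) (e : A).

Lemma cvg_mulr_cst (T : Type) (F : set_system T) (FF : Filter F)
    (f : T -> A) (l b : A) :
  f x @[x --> F] --> l -> f x * b @[x --> F] --> l * b.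
Proof.
move=> /cvgrPdist_lt fl; apply/cvgrPdist_lt => eps eps0.
have b1 : 0 < `|b| + 1 by rewrite ltr_wpDl.
near=> x; rewrite -mulrBl (le_lt_trans (norm_mulr _ _))//.
apply: (@le_lt_trans _ _ (`|l - f x| * (`|b| + 1))).
  by rewrite ler_wpM2l// lerDl.
by rewrite -ltr_pdivlMr//; near: x; apply: fl; rewrite divr_gt0.
Unshelve. all: by end_near. Qed.

(** For a projection e this is the left ideal A e, described by an equation so
    that it is visibly closed. *)
Definition right_fixed : {pred A} := [pred x : A | x * e == x].

Lemma right_fixed_submod_closed : submod_closed right_fixed.
Proof.
split=> [|c x y]; rewrite !inE ?mul0r// => /eqP xe /eqP ye.
by rewrite mulrDl mulrZl xe ye.
Qed.

HB.instance Definition _ :=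
  GRing.isSubmodClosed.Build R[i] A right_fixed right_fixed_submod_closed.

Record right_fixed_ideal := RightFixedIdeal {
  ideal_val :> A;
  _ : ideal_val \in right_fixed
}.

HB.instance Definition _ := [isSub for ideal_val].
HB.instance Definition _ := [Choice of right_fixed_ideal by <:].
HB.instance Definition _ := [SubChoice_isSubLmodule of right_fixed_ideal by <:].

Let ideal_norm (x : right_fixed_ideal) : R[i] := `|ideal_val x|.

Let ideal_normD x y : ideal_norm (x + y) <= ideal_norm x + ideal_norm y.
Proof. exact: ler_normD. Qed.

Let ideal_normZ (c : R[i]) x : ideal_norm (c *: x) = `|c| * ideal_norm x.
Proof. exact: normrZ. Qed.

Let ideal_norm0_eq0 x : ideal_norm x = 0 -> x = 0.
Proof. by move=> /normr0_eq0 x0; apply: val_inj. Qed.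

HB.instance Definition _ := Lmodule_isNormed.Build R[i] right_fixed_ideal
  ideal_normD ideal_normZ ideal_norm0_eq0.

Lemma ideal_mulr (x : right_fixed_ideal) : ideal_val x * e = ideal_val x.
Proof. by case: x => x /= /eqP. Qed.

(** A limit in A of elements of the ideal again satisfies x e = x, by continuity
    of the multiplication. *)
Lemma right_fixed_ideal_complete (F : set_system right_fixed_ideal) :
  ProperFilter F -> cauchy F -> cvg F.
Proof.
move=> FF /cauchy_ballP Fc.
have /cauchy_cvgP : cauchy (ideal_val x @[x --> F]).
  apply/cauchy_ballP => eps eps0; have := Fc _ eps0.
  case=> -[P Q] /= [FP FQ] PQ.
  exists (ideal_val @` P, ideal_val @` Q) => /=.
    split.
      by apply: filterS FP => x Px; exists x.
    by apply: filterS FQ => x Px; exists x.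
  move=> [_ _] /= [[x Px <-] [y Qy <-]]; have := PQ (x, y) (conj Px Qy).
  by rewrite -!ball_normE.
move=> /cvg_ex[l Fl].
have le : l \in right_fixed.
  rewrite inE; apply/eqP; have := cvg_mulr_cst FF (b := e) Fl.
  rewrite (_ : (fun x => _) = ideal_val); last first.
    by apply/funext => x; rewrite ideal_mulr.
  by move=> Fle; apply: (norm_cvg_unique Fle Fl).
apply/cvg_ex; exists (RightFixedIdeal le).
by apply/cvgrPdist_lt => eps eps0; move/cvgrPdist_lt : Fl => /(_ _ eps0).
Qed.

HB.instance Definition _ :=
  Uniform_isComplete.Build right_fixed_ideal right_fixed_ideal_complete.

End RightFixedIdeal.

Section MinimalLeftIdeal.
Variables (R : realType) (A : cstarType R) (e : A) (he : minimal_projection e).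

Let se : star e = e. Proof. by case: he => -[]. Qed.
Let ee : e * e = e. Proof. by case: he => -[]. Qed.

(** The proof that [e] is minimal is an argument of the type, so that the Hilbert
    space structure, which depends on it, can be attached to the type. *)
Definition minimal_left_ideal of minimal_projection e := right_fixed_ideal e.

Local Notation H := (minimal_left_ideal he).

HB.instance Definition _ := CompleteNormedModule.copy H (right_fixed_ideal e).

Let hdot (x y : H) : R[i] := corner_coef e (star (ideal_val y) * ideal_val x).

Lemma star_mul_idealE (x y : H) :
  star (ideal_val y) * ideal_val x = hdot x y *: e.
Proof.
have ey : e * star (ideal_val y) = star (ideal_val y).
  by rewrite -[X in X * _]se -starMr ideal_mulr.
by rewrite -corner_coefE// mulrA ey -mulrA ideal_mulr.
Qed.

Let hdot_linear (c : R[i]) (x y z : H) :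
  hdot (c *: x + y) z = c * hdot x z + hdot y z.
Proof.
apply: (minimal_scaleI he).
rewrite -star_mul_idealE scalerDl -scalerA -!star_mul_idealE.
by rewrite mulrDr mulrZr.
Qed.

Let hdotC (x y : H) : hdot x y = (hdot y x)^*.
Proof.
apply: (minimal_scaleI he); rewrite -star_mul_idealE -[in RHS]se -starZ.
by rewrite -star_mul_idealE starMr starK.
Qed.

Let hdot_norm (x : H) : `|x| ^+ 2 = hdot x x.
Proof.
have d0 : 0 <= hdot x x.
  by apply: (minimal_star_mul_ge0 he (ideal_mulr x)); exact: star_mul_idealE.
rewrite [LHS](_ : _ = `|star (ideal_val x) * ideal_val x|); last first.
  by rewrite norm_star_mul.
by rewrite star_mul_idealE normrZ norm_minimal_projection// mulr1 ger0_norm.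
Qed.

HB.instance Definition _ :=
  isHilbertSpace.Build R H hdot_linear hdotC hdot_norm.

Lemma ideal_dotE (x y : H) :
  star (ideal_val y) * ideal_val x = dot x y *: e.
Proof. exact: star_mul_idealE. Qed.

Lemma ideal_mul_subproof (a : A) (x : H) : a * ideal_val x \in right_fixed e.
Proof. by rewrite inE -mulrA ideal_mulr. Qed.

Definition ideal_mul (a : A) (x : H) : H :=
  RightFixedIdeal (ideal_mul_subproof a x).

Lemma ideal_mul_representation : star_representation ideal_mul.
Proof.
split.
- by move=> a c x y; apply: val_inj; rewrite /= mulrDr mulrZr.
- by move=> a; exists `|a| => x; exact: norm_mulr.
- by move=> x c a b; apply: val_inj; rewrite /= mulrDl mulrZl.
- by move=> a b x; apply: val_inj; rewrite /= mulrA.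
- move=> a x y; apply: (minimal_scaleI he); rewrite -!ideal_dotE/=.
  by rewrite starMr starK mulrA.
Qed.

Lemma ideal_unit_subproof : e \in right_fixed e.
Proof. by rewrite inE ee. Qed.

Definition ideal_unit : H := RightFixedIdeal ideal_unit_subproof.

Lemma ideal_mul_unit : ideal_mul e ideal_unit = ideal_unit.
Proof. by apply: val_inj. Qed.

Lemma dot_ideal_unit : dot ideal_unit ideal_unit = 1.
Proof.
by apply: (minimal_scaleI he); rewrite -ideal_dotE /= se ee scale1r.
Qed.

End MinimalLeftIdeal.

(** * Convergence over the complex numbers *)

Section ComplexScalars.
Variable R : realType.

Lemma ge0_complexP (x : R[i]) : 0 <= x ->
  exists2 r : R, 0 <= r & x = real_complex R r.
Proof.
move=> x0; have xE := RRe_real (ger0_real x0).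
by exists (complex.Re x); rewrite -?ler0c ?xE.
Qed.

Lemma expr_lt1_eventually_small (q M eps : R[i]) : 0 <= q -> q < 1 -> 0 <= M ->
  0 < eps -> exists n, q ^+ n * M < eps.
Proof.
move=> /ge0_complexP[q' q'0 ->] q1 /ge0_complexP[M' M'0 ->] eps0.
have [eps' _ epsE] := ge0_complexP (ltW eps0).
rewrite epsE in eps0 *.
have q'1 : `|q'| < 1 by rewrite ger0_norm// -ltcR.
have eps'0 : 0 < eps' by rewrite -ltcR.
have /cvgrPdist_lt /(_ _ eps'0)[N _ HN] := cvg_geometric M' q'1.
exists N; rewrite -rmorphXn/= -rmorphM ltcR mulrC.
have := HN N (leqnn _); rewrite sub0r normrN /geometric/= ger0_norm//.
by rewrite mulr_ge0// exprn_ge0.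
Qed.

Lemma invS_small (eps : R[i]) : 0 < eps -> exists N, forall n, (N <= n)%N ->
  n.+1%:R^-1 < eps.
Proof.
move=> eps0; have [r _ epsE] := ge0_complexP (ltW eps0); rewrite epsE in eps0 *.
have r0 : 0 < r by rewrite -ltcR.
have [N _ HN] := near_infty_natSinv_lt (PosNum r0).
exists N => n /HN /=; rewrite -ltcR fmorphV/= rmorph_nat.
by [].
Qed.

End ComplexScalars.

Lemma cauchy_seq_cvg (K : numFieldType) (V : completeNormedModType K)
    (u : nat -> V) :
  (forall eps, 0 < eps ->
    exists N, forall n, (N <= n)%N -> `|u N - u n| < eps) ->
  cvgn u.
Proof.
move=> uc; apply/cauchy_cvgP/cauchyP => eps eps0.
have [N HN] := uc _ eps0; exists (u N); exists N => // n Nn.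
by rewrite -ball_normE; exact: HN.
Qed.

Lemma norm_lt_eps_eq0 (K : numFieldType) (V : normedModType K) (x : V) :
  (forall eps, 0 < eps -> `|x| < eps) -> x = 0.
Proof.
move=> xe; apply/eqP; apply/negPn/negP => x0.
by have := xe `|x|; rewrite normr_gt0 ltxx => /(_ x0).
Qed.

Section ComplexSequences.
Variable R : realType.

(** The real and imaginary parts are Cauchy sequences of real numbers. *)
Lemma complex_cauchy_seq (u : nat -> R[i]) :
  (forall eps, 0 < eps ->
    exists N, forall n, (N <= n)%N -> `|u N - u n| < eps) ->
  exists l, forall eps, 0 < eps ->
    exists N, forall n, (N <= n)%N -> `|l - u n| < eps.
Proof.
move=> uc.
have norm_i : `|'i%C| = 1 :> R[i].
  by rewrite normc_def/= expr0n add0r expr1n sqrtr1.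
have Im_le (z : R[i]) : real_complex R `|complex.Im z| <= `|z|.
  (* the imaginary part of z is the real part of - i z *)
  have := normc_ge_Re (z * - 'i%C); rewrite normrM normrN norm_i.
  by rewrite mulr1 mulrN raddfN/= ReiNIm opprK.
have cvg_coord (f : R[i] -> R) : (forall z w, f (z - w) = f z - f w) ->
    (forall z, real_complex R `|f z| <= `|z|) -> cvgn (f \o u).
  move=> fB f_le; apply: cauchy_seq_cvg => eps eps0.
  have [N HN] := uc (real_complex R eps) ltac:(by rewrite ltcR).
  exists N => n /HN; rewrite -fB -ltcR; exact: le_lt_trans.
have /cvg_ex[a /cvgrPdist_lt ha] := cvg_coord _ (raddfB _) (@normc_ge_Re R).
have /cvg_ex[b /cvgrPdist_lt hb] := cvg_coord _ (raddfB _) Im_le.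
exists (Complex a b) => eps eps0.
have [r _ epsE] := ge0_complexP (ltW eps0); rewrite epsE in eps0 *.
have r0 : 0 < r / 2 by rewrite divr_gt0// -ltcR.
have [N1 _ HN1] := ha _ r0; have [N2 _ HN2] := hb _ r0.
exists (maxn N1 N2) => n; rewrite geq_max => /andP[/HN1 /= h1 /HN2 /= h2].
rewrite [_ - _]complexE (le_lt_trans (ler_normD _ _))// normrM.
rewrite norm_i mul1r !normc_def/= expr0n/= !addr0 !sqrtr_sqr -rmorphD ltcR.
by move: h1 h2; case: (u n) => c d /= h1 h2; rewrite (splitr r) ltrD.
Qed.

End ComplexSequences.

(** * Fixed points and square roots *)

(** The number M = |x0 - T x0| / (1 - q) solves M = |x0 - T x0| + q M, so it bounds
    the distance of x0 to all its iterates; hence the tail of the sequence of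
    iterates from N on stays within q^N M of the N-th one. *)
Lemma banach_contraction (R : realType) (V : completeNormedModType R[i])
    (D : set V) (T : V -> V) (q : R[i]) (x0 : V) :
  closed D -> (forall x, D x -> D (T x)) -> 0 <= q -> q < 1 ->
  (forall x y, D x -> D y -> `|T x - T y| <= q * `|x - y|) -> D x0 ->
  exists2 x, D x & T x = x.
Proof.
move=> Dcl TD q0 q1 Tq Dx0; pose u n := iter n T x0.
have Du n : D (u n) by elim: n => //= n; exact: TD.
pose M := `|x0 - T x0| / (1 - q).
have q10 : 0 < 1 - q by rewrite subr_gt0.
have M0 : 0 <= M by rewrite divr_ge0// ltW.
have u0M m : `|x0 - u m| <= M.
  elim: m => [|m ih]; first by rewrite subrr normr0.
  have -> : M = `|x0 - T x0| + q * M.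
    have -> : `|x0 - T x0| = M * (1 - q) by rewrite divfK// gt_eqF.
    by rewrite mulrBr mulr1 (mulrC q) subrK.
  rewrite -(subrKA (T x0)) (le_trans (ler_normD _ _))// lerD2l.
  by rewrite (le_trans (Tq _ _ _ _))// ler_wpM2l.
have uNM N m : `|u N - u (N + m)%N| <= q ^+ N * M.
  elim: N => [|N ih]; first by rewrite expr0 mul1r add0n u0M.
  by rewrite addSn /= (le_trans (Tq _ _ _ _))// exprS -mulrA ler_wpM2l.
have : cvgn u.
  apply: cauchy_seq_cvg => eps eps0.
  have [N HN] := expr_lt1_eventually_small q0 q1 M0 eps0.
  by exists N => n Nn; rewrite -(subnKC Nn) (le_lt_trans (uNM _ _)).
move=> /cvg_ex[x ux]; have Dx : D x.
  by apply: (closed_cvg D Dcl _ _ ux); apply: nearW.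
exists x => //; have uSx : u n.+1 @[n --> \oo] --> x by rewrite cvg_shiftS.
apply: (norm_cvg_unique _ uSx).
apply/cvgrPdist_lt => eps eps0; move/cvgrPdist_lt : ux => /(_ _ eps0).
apply: filterS => n; apply: le_lt_trans.
by rewrite (le_trans (Tq _ _ _ _))// ler_piMl// ltW.
Qed.

Lemma closed_kernel (R : realType) (V W : normedModType R[i]) (f : V -> W) :
  (forall x y, f (x - y) = f x - f y) ->
  (exists2 M, 0 <= M & forall x, `|f x| <= M * `|x|) ->
  closed [set x | f x = 0].
Proof.
move=> fB [M M0 fM] x clx /=; apply: norm_lt_eps_eq0 => eps eps0.
have d0 : 0 < eps / (M + 1) by rewrite divr_gt0// ltr_wpDl.
have [y [/= fy]] := clx _ (nbhsx_ballx x _ d0).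
rewrite -ball_normE /= => xy.
rewrite -[f x]subr0 -fy -fB (le_lt_trans (fM _))//.
rewrite (@le_lt_trans _ _ ((M + 1) * `|x - y|)) ?ler_wpM2r ?lerDl//.
by rewrite mulrC -ltr_pdivlMr// ltr_wpDl.
Qed.

Lemma closed_norm_le (R : realType) (V : normedModType R[i]) (q : R[i]) :
  0 <= q -> closed [set x : V | `|x| <= q].
Proof.
move=> q0 x clx /=; rewrite real_leNgt ?ger0_real//; apply/negP => qx.
have d0 : 0 < `|x| - q by rewrite subr_gt0.
have [y [/= yq]] := clx _ (nbhsx_ballx x _ d0).
rewrite -ball_normE /= ltrBrDr => xyq.
have := ler_normD (x - y) y; rewrite subrK => xle.
by have := le_lt_trans (le_trans xle (lerD (lexx _) yq)) xyq; rewrite ltxx.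
Qed.

Section SquareRoot.
Variables (R : realType) (A : cstarType R).

(** With g = 1 - r, the equation g^2 = 1 - k reads r = (k + r^2) / 2. The right-hand
    side is a contraction of the ball of radius q, of ratio q, and it preserves
    the closed set of self-adjoint elements that commute with everything that
    commutes with k. *)
Lemma sqrt_one_sub (k : A) (q : R[i]) : star k = k -> 0 <= q -> q < 1 ->
  `|k| <= q -> exists g, [/\ star g = g, g * g = 1 - k
    & forall h, h * k = k * h -> h * g = g * h].
Proof.
move=> sk q0 q1 kq.
pose D := [set r : A | star r = r /\ `|r| <= q /\
  forall h, h * k = k * h -> h * r = r * h].
pose T (r : A) : A := 2^-1 *: (k + r * r).
have half : `|2^-1 : R[i]| = 2^-1 by rewrite ger0_norm// invr_ge0.
have [] := @banach_contraction R A D T q 0 _ _ q0 q1.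
- pose comm_k := [set h | h * k = k * h].
  rewrite (_ : D = [set r | star r - r = 0] `&` ([set r | `|r| <= q] `&`
      \bigcap_(h in comm_k) [set r | h * r - r * h = 0])); last first.
    apply/seteqP; split=> r /= [sr [rq rh]].
      rewrite sr subrr; split=> //; split=> // h hk /=.
      by rewrite rh ?subrr.
    by split; [exact: subr0_eq|split=> // h /rh /subr0_eq].
  apply: closedI; [|apply: closedI; [exact: closed_norm_le|]].
    apply: closed_kernel => [x y|]; first by rewrite starB opprD addrACA -opprD.
    exists 2 => // x; rewrite (le_trans (ler_normB _ _))// norm_star.
    by rewrite mulr_natl mulr2n.
  apply: closed_bigI => h _; apply: closed_kernel => [x y|].
    by rewrite mulrBr mulrBl opprD addrACA -opprD.
  exists (2 * `|h|) => [|x]; first by rewrite mulr_ge0.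
  rewrite (le_trans (ler_normB _ _))// -mulrA mulr_natl mulr2n.
  by rewrite lerD// (le_trans (norm_mulr _ _))// mulrC.
- move=> r [sr [rq rh]]; split; [|split].
  + rewrite starZ starD sk starMr sr; congr (_ *: _).
    by apply/CrealP; rewrite ger0_real.
  + rewrite normrZ half ler_pdivrMl// mulr_natl mulr2n.
    rewrite (le_trans (ler_normD _ _))// lerD// (le_trans (norm_mulr _ _))//.
    by rewrite (le_trans (ler_pM _ _ rq rq))// ler_piMr// ltW.
  + move=> h hk; rewrite mulrZl mulrZr mulrDr mulrDl hk; congr (_ *: (_ + _)).
    by rewrite mulrA (rh h hk) -mulrA (rh h hk) mulrA.
- move=> x y [_ [xq _]] [_ [yq _]].
  rewrite -scalerBr opprD addrACA subrr add0r normrZ half ler_pdivrMl//.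
  have -> : x * x - y * y = x * (x - y) + (x - y) * y.
    by rewrite mulrBr mulrBl addrA subrK.
  rewrite (le_trans (ler_normD _ _))// mulr_natl mulr2n lerD//.
    by rewrite (le_trans (norm_mulr _ _))// ler_wpM2r.
  by rewrite (le_trans (norm_mulr _ _))// mulrC ler_wpM2r.
- by split; rewrite ?star0// normr0; split=> // h _; rewrite mulr0 mul0r.
move=> r [sr [_ rh]] Tr; exists (1 - r); split.
- by rewrite starB star1 sr.
- have rr : r * r = r + r - k.
    have two : 2^-1 + 2^-1 = 1 :> R[i] by rewrite [RHS]splitr mul1r.
    rewrite -[X in X + _ - k]Tr -[X in _ + X - k]Tr /T -scalerDl two scale1r.
    by rewrite addrC addKr.
  rewrite mulrBr mulr1 mulrBl mul1r opprB rr.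
  by rewrite (addrAC (r + r)) addrK addrA subrK.
- by move=> h hk; rewrite mulrBr mulrBl mulr1 mul1r (rh h hk).
Qed.

End SquareRoot.

(** * Unital *-homomorphisms are contractive *)

Section UnitalStarMorphism.
Variables (R : realType) (A B : cstarType R) (f : A -> B).
Hypotheses (f_linear : linear f) (f_mul : {morph f : a b / a * b})
  (f_star : forall a, star (f a) = f (star a)) (f1 : f 1 = 1).

(** With g = (1 - h^2)^(1/2), which commutes with h, the element f h + i f g is
    unitary and f h is its real part. *)
Lemma unital_star_morphism_selfadjoint_le1 h :
  star h = h -> `|h| < 1 -> `|f h| <= 1.
Proof.
move=> sh h1.
have hh : `|h * h| = `|h| ^+ 2 by rewrite -norm_star_mul sh.
have [||||g [sg gg gh]] := @sqrt_one_sub R A (h * h) (`|h| ^+ 2) _ _ _ _.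
- by rewrite starMr sh.
- by rewrite exprn_ge0.
- by rewrite expr_lt1.
- by rewrite hh.
have hg : h * g = g * h by apply: gh; rewrite mulrA.
have sfh : star (f h) = f h by rewrite f_star sh.
have sfg : star (f g) = f g by rewrite f_star sg.
pose w := f h + 'i *: f g.
have sw : star w = f h - 'i *: f g.
  by rewrite starD starZ sfh sfg conjCi scaleNr.
have ww : star w * w = 1.
  rewrite sw mulrDr !mulrBl !mulrZl !mulrZr -!f_mul hg scalerA.
  rewrite -(expr2 'i) sqrCi.
  by rewrite scaleN1r opprK addrA subrK gg linear_funB// f1 addrC subrK.
have -> : f h = 2^-1 *: (star w + w).
  rewrite sw addrACA addNr addr0 -mulr2n -[f h *+ 2]scaler_nat scalerA.
  by rewrite mulVf ?scale1r.
rewrite normrZ ger0_norm ?invr_ge0// ler_pdivrMl// mulr1.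
rewrite (le_trans (ler_normD _ _))// norm_star.
by rewrite -[2]/(1 + 1) lerD// norm_unitary_le1.
Qed.

(** The C*-identity reduces the bound to the self-adjoint element a^* a, which can
    be rescaled to have norm less than 1. *)
Lemma unital_star_morphism_contractive a : `|f a| <= `|a|.
Proof.
have sa h t : star h = h -> `|h| < t -> `|f h| <= t.
  move=> sh ht; have t0 : 0 < t by exact: le_lt_trans ht.
  have tV0 : 0 <= t^-1 by rewrite invr_ge0 ltW.
  have : `|f (t^-1 *: h)| <= 1.
    apply: unital_star_morphism_selfadjoint_le1.
      by rewrite starZ sh; congr (_ *: _); apply/CrealP; rewrite ger0_real.
    by rewrite normrZ (ger0_norm tV0) mulrC ltr_pdivrMr// mul1r.
  by rewrite linear_funZ// normrZ (ger0_norm tV0) mulrC ler_pdivrMr// mul1r.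
rewrite real_leNgt ?normr_real//; apply/negP => af.
have : `|star a * a| < `|f a| ^+ 2 by rewrite norm_star_mul ltrXn2r.
(* the bound on self-adjoint elements is applied at the midpoint *)
move=> /[dup] /midf_lt[ht ts] _.
have := sa (star a * a) _ _ ht; rewrite starMr starK => /(_ erefl).
by rewrite f_mul -f_star norm_star_mul => /le_lt_trans/(_ ts); rewrite ltxx.
Qed.

End UnitalStarMorphism.

(** * Density and closed lines *)

Section NormedModules.
Variables (R : realType) (V : normedModType R[i]).

Lemma denseP (S : set V) : dense S <->
  forall x eps, 0 < eps -> exists2 y, S y & `|x - y| < eps.
Proof.
split=> [dS x eps eps0|dS O [x Ox] Oop].
  have [||y [xy Sy]] := dS (ball x eps); [|exact: ball_open|].
    by exists x; exact: ballxx.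
  by exists y => //; move: xy; rewrite -ball_normE.
have /nbhs_ballP[eps /= eps0 xO] := open_nbhs_nbhs (conj Oop Ox).
have [y Sy xy] := dS x _ eps0; exists y; split=> //.
by apply: xO; rewrite -ball_normE.
Qed.

(** If c_n g converges and g is nonzero, then c_n is a Cauchy sequence of
    scalars. *)
Lemma line_closed (g x : V) :
  (forall eps, 0 < eps -> exists c : R[i], `|x - c *: g| < eps) ->
  exists c : R[i], x = c *: g.
Proof.
move=> xg; have [g0|g0] := eqVneq g 0.
  exists 0; rewrite scale0r; apply: norm_lt_eps_eq0 => eps /xg[c].
  by rewrite g0 scaler0 subr0.
have ng0 : 0 < `|g| by rewrite normr_gt0.
have /choice[c xc] n : exists c : R[i], `|x - c *: g| < n.+1%:R^-1.
  by apply: xg; rewrite invr_gt0 ltr0Sn.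
have [eps eps0|l cl] := @complex_cauchy_seq R c.
  have eg0 : 0 < eps * `|g| / 2 by rewrite divr_gt0// mulr_gt0.
  have [N HN] := invS_small eg0; exists N => n Nn.
  rewrite -(ltr_pM2r ng0) -normrZ (splitr (eps * _)) scalerBl -(subrKA x).
  rewrite (le_lt_trans (ler_normD _ _))// ltrD//.
    by rewrite distrC (lt_trans (xc N))// (HN N).
  by rewrite (lt_trans (xc n))// (HN n).
exists l; apply: subr0_eq; apply: norm_lt_eps_eq0 => eps eps0.
have e20 : 0 < eps / 2 by rewrite divr_gt0.
have eg0 : 0 < eps / 2 / `|g| by rewrite divr_gt0.
have [N1 HN1] := invS_small e20; have [N2 HN2] := cl _ eg0.
pose n := maxn N1 N2.
rewrite -(subrKA (c n *: g)) (le_lt_trans (ler_normD _ _))//.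
rewrite (splitr eps) ltrD//.
  by rewrite (lt_trans (xc n))// HN1// leq_maxl.
by rewrite -scalerBl normrZ -ltr_pdivlMr// distrC HN2// leq_maxr.
Qed.

End NormedModules.

(** * Elementary tensors in the spatial tensor product *)

Section SpatialTensor.
Variables (R : realType) (A B AB : cstarType R) (tens : A -> B -> AB).
Hypothesis tensP : is_spatial_tensor tens.

Lemma tens0l b : tens 0 b = 0.
Proof. exact: linear_fun0 (tens_linearl tensP b). Qed.

Lemma tens0r a : tens a 0 = 0.
Proof. exact: linear_fun0 (tens_linearr tensP a). Qed.

(** a (x) b is the product of the images of a and b under the unital
    *-homomorphisms a |-> a (x) 1 and b |-> 1 (x) b. *)
Lemma norm_tens_le a b : `|tens a b| <= `|a| * `|b|.
Proof.
have la : `|tens a 1| <= `|a|.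
  apply: (@unital_star_morphism_contractive _ _ _ (tens^~ 1)).
  - exact: tens_linearl tensP _.
  - by move=> x y; rewrite (tensM tensP) mulr1.
  - by move=> x; rewrite (tens_star tensP) star1.
  - exact: tens1 tensP.
have lb : `|tens 1 b| <= `|b|.
  apply: (@unital_star_morphism_contractive _ _ _ (tens 1)).
  - exact: tens_linearr tensP _.
  - by move=> x y; rewrite (tensM tensP) mulr1.
  - by move=> x; rewrite (tens_star tensP) star1.
  - exact: tens1 tensP.
have -> : tens a b = tens a 1 * tens 1 b by rewrite (tensM tensP) mulr1 mul1r.
by rewrite (le_trans (norm_mulr _ _))// ler_pM.
Qed.

Lemma tensor_norm_seq1 (H K : hilbertType R) (x : H) (y : K) :
  dot x x = 1 -> dot y y = 1 -> tensor_norm [:: (x, y)] = 1.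
Proof.
move=> xx yy; rewrite /tensor_norm /tensor_sqnorm !big_seq1 /= xx yy.
by rewrite mulr1 sqrtr1.
Qed.

(** In the representation on A e and B f, the element e (x) f fixes the unit vector
    e (x) f, so its spatial norm is at least 1. *)
Lemma tens_minimal_neq0 e f : minimal_projection e -> minimal_projection f ->
  tens e f != 0.
Proof.
move=> he hf; apply/eqP => ef0.
have := tens_norm tensP [:: (e, f)]; rewrite big_seq1 /= ef0 normr0 /= => n0.
suff : (1%:E <= spatial_norm [:: (e, f)])%E by rewrite -n0 lee_fin ler10.
apply: ereal_sup_ubound.
exists (minimal_left_ideal he), (minimal_left_ideal hf),
  (@ideal_mul _ _ _ he), (@ideal_mul _ _ _ hf),
  [:: (ideal_unit he, ideal_unit hf)].
have n1 : tensor_norm [:: (ideal_unit he, ideal_unit hf)] = 1.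
  by apply: tensor_norm_seq1; exact: dot_ideal_unit.
split; [exact: ideal_mul_representation..|by rewrite n1|].
by rewrite /tensor_apply /= !ideal_mul_unit n1.
Qed.

(** For finite sums of elementary tensors, compression by e (x) f is given by the
    coefficients of e A e = C e and f B f = C f; the general case follows by
    density, as C (e (x) f) is closed. *)
Lemma tens_minimal_projection e f : minimal_projection e ->
  minimal_projection f -> minimal_projection (tens e f).
Proof.
move=> he hf; have ef0 := tens_minimal_neq0 he hf.
case: (he) (hf) => -[se ee] _ _ [[sf ff] _ _].
have gg : tens e f * tens e f = tens e f by rewrite (tensM tensP) ee ff.
split=> //; first by split=> //; rewrite (tens_star tensP) se sf.
have compress_sum (t : seq (A * B)) :
    tens e f * (\sum_(p <- t) tens p.1 p.2) * tens e f =
    (\sum_(p <- t) corner_coef e p.1 * corner_coef f p.2) *: tens e f.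
  rewrite mulr_sumr mulr_suml scaler_suml; apply: eq_bigr => p _.
  rewrite !(tensM tensP) !corner_coefE// (linear_funZ (tens_linearr tensP _)).
  by rewrite (linear_funZ (tens_linearl tensP _)) scalerA mulrC.
apply/seteqP; split=> x /= [c _ <-]; last first.
  by exists (c *: tens e f) => //; rewrite mulrZr mulrZl !gg.
suff [d ->] : exists d : R[i], tens e f * c * tens e f = d *: tens e f.
  by exists d.
apply: line_closed => eps eps0.
pose M := `|tens e f| + 1.
have M0 : 0 < M by rewrite ltr_wpDl.
have eM0 : 0 < eps / (M * M) by rewrite divr_gt0// mulr_gt0.
have /denseP/(_ c _ eM0)[_ [t ->] ct] := tens_dense tensP.
exists (\sum_(p <- t) corner_coef e p.1 * corner_coef f p.2).
rewrite -compress_sum -mulrBl -mulrBr.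
rewrite ltr_pdivlMr ?mulr_gt0// in ct; apply: le_lt_trans ct.
have gM : `|tens e f| <= M by rewrite lerDl.
rewrite (le_trans (norm_mulr _ _))// mulrA ler_pM//.
by rewrite (le_trans (norm_mulr _ _))// mulrC ler_wpM2l.
Qed.

End SpatialTensor.

(** * The tensor product of Hilbert modules *)

Section ModuleTensor.
Variables (R : realType) (A B AB : cstarType R) (tens : A -> B -> AB).
Hypothesis tensP : is_spatial_tensor tens.
Variables (E : hilbertModType A) (F : hilbertModType B).
Variable EF : hilbertModType AB.
Variable mtens : E -> F -> EF.
Hypothesis mtensP : is_module_tensor tens mtens.

Lemma norm_inner (C : cstarType R) (G : hilbertModType C) (x : G) :
  `|x| ^+ 2 = `|inner x x|.
Proof. by rewrite inner_norm sqrtCK. Qed.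

Lemma norm_mtens_le x y : `|mtens x y| <= `|x| * `|y|.
Proof.
rewrite -(@ler_pXn2r _ 2)// ?nnegrE ?mulr_ge0//.
by rewrite exprMn !norm_inner (mtens_inner mtensP) norm_tens_le.
Qed.

Lemma mtens_generated (I J : Type) (u : I -> E) (v : J -> F) x y :
  generated_submodule u x -> generated_submodule v y ->
  generated_submodule (fun p : I * J => mtens (u p.1) (v p.2)) (mtens x y).
Proof.
move=> [s ->] [t ->].
exists [seq (tens p.1 q.1, (p.2, q.2)) | p <- s, q <- t].
rewrite big_allpairs_dep/= (linear_fun_sum (mtens_linearl mtensP _)).
apply: eq_bigr => p _; rewrite (linear_fun_sum (mtens_linearr mtensP _)).
by apply: eq_bigr => q _; rewrite (mtens_act mtensP).
Qed.

Lemma mtens_approx (S : set E) (T : set F) x y eps : dense S -> dense T ->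
  0 < eps -> exists x' y', [/\ S x', T y' & `|mtens x y - mtens x' y'| < eps].
Proof.
move=> /denseP dS /denseP dT eps0.
have e20 : 0 < eps / 2 by rewrite divr_gt0.
have M0 (r : R[i]) : 0 <= r -> 0 < r + 1 by move=> ?; rewrite ltr_wpDl.
have [x' Sx' xx'] := dS x _ (divr_gt0 e20 (M0 _ (normr_ge0 y))).
have [y' Ty' yy'] := dT y _ (divr_gt0 e20 (M0 _ (normr_ge0 x'))).
exists x', y'; split=> //.
rewrite -(subrKA (mtens x' y)) -(linear_funB (mtens_linearl mtensP _)).
rewrite -(linear_funB (mtens_linearr mtensP _)).
rewrite (le_lt_trans (ler_normD _ _))// (splitr eps) ltrD//.
  rewrite ltr_pdivlMr ?M0// in xx'; rewrite (le_lt_trans _ xx')//.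
  by rewrite (le_trans (norm_mtens_le _ _))// ler_wpM2l// lerDl.
rewrite ltr_pdivlMr ?M0// in yy'; rewrite (le_lt_trans _ yy')//.
by rewrite (le_trans (norm_mtens_le _ _))// mulrC ler_wpM2l// lerDl.
Qed.

Lemma generated_submoduleD (C : cstarType R) (G : hilbertModType C) (L : Type)
    (w : L -> G) x y : generated_submodule w x -> generated_submodule w y ->
  generated_submodule w (x + y).
Proof. by move=> [s ->] [t ->]; exists (s ++ t); rewrite big_cat. Qed.

Lemma mtens_dense_generated (I J : Type) (u : I -> E) (v : J -> F) :
  dense (generated_submodule u) -> dense (generated_submodule v) ->
  dense (generated_submodule (fun p : I * J => mtens (u p.1) (v p.2))).
Proof.
move=> du dv; set G := generated_submodule _.
have sum_approx (s : seq (E * F)) eps : 0 < eps ->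
    exists2 z, G z & `|\sum_(p <- s) mtens p.1 p.2 - z| < eps.
  elim: s eps => [|[x y] s ih] eps eps0.
    by exists 0; [exists [::]; rewrite big_nil|rewrite big_nil subrr normr0].
  have e20 : 0 < eps / 2 by rewrite divr_gt0.
  have [x' [y' [ux' vy' xy]]] := mtens_approx x y du dv e20.
  have [z Gz sz] := ih _ e20; exists (mtens x' y' + z).
    by apply: generated_submoduleD => //; exact: mtens_generated.
  rewrite big_cons opprD addrACA (le_lt_trans (ler_normD _ _))//.
  by rewrite (splitr eps) ltrD.
apply/denseP => z eps eps0; have e20 : 0 < eps / 2 by rewrite divr_gt0.
have /denseP/(_ z _ e20)[_ [s ->] zs] := mtens_dense mtensP.
have [y Gy sy] := sum_approx s _ e20; exists y => //.
rewrite -(subrKA (\sum_(p <- s) mtens p.1 p.2)) (le_lt_trans (ler_normD _ _))//.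
by rewrite (splitr eps) ltrD.
Qed.

Lemma mtens_orthonormal_system (I J : eqType) (u : I -> E) (v : J -> F) :
  orthonormal_system u -> orthonormal_system v ->
  orthonormal_system (fun p : I * J => mtens (u p.1) (v p.2)).
Proof.
move=> [bu ou] [bv ov]; split=> [[i j]|[i j] [k l] ne] /=.
  rewrite /basic (mtens_inner mtensP); apply: tens_minimal_projection => //.
    exact: bu.
  exact: bv.
rewrite (mtens_inner mtensP); have [ik|/eqP/ou ->] := eqVneq i k.
  rewrite ov ?(tens0r tensP)// => jl.
  by apply: ne; rewrite ik jl.
exact: tens0l.
Qed.

End ModuleTensor.

Theorem theorem3p2 (R : realType) (A B : cstarType R)
  (E : hilbertModType A) (F : hilbertModType B)
  (AB : cstarType R) (tens : A -> B -> AB)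
  (hAB : is_spatial_tensor tens)
  (EF : hilbertModType AB) (mtens : E -> F -> EF)
  (hEF : is_module_tensor tens mtens)
  (I J : countType) (u : I -> E) (v : J -> F)
  (hu : orthonormal_basis u) (hv : orthonormal_basis v) :
  orthonormal_basis (fun p : I * J => mtens (u p.1) (v p.2)).
Proof.
split; first exact: (mtens_orthonormal_system hAB hEF hu.1 hv.1).
exact: (mtens_dense_generated hAB hEF hu.2 hv.2).
Qed.
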